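(* Let $\alpha\in\mathbb{R}\setminus\pi\mathbb{Z}$ and $z=\rho i$ with $\rho\in\mathbb{R}\setminus\{0\}$, and let $\mathcal{O}_\alpha$ be the integral transform with parameters $\alpha,z$ defined in the context. Then $\mathcal{O}_\alpha$ is a bounded linear operator from $L^1(\mathbb{R})$ to $C_0(\mathbb{R})$; in particular, if $f\in L^1(\mathbb{R})$ then $\mathcal{O}_\alpha[f]\in C_0(\mathbb{R})$. Moreover, for every $f\in L^1(\mathbb{R})$, $$\|\mathcal{O}_\alpha[f]\|_\infty\le \frac{|\csc\alpha|}{\sqrt{2\pi}}\sqrt{\frac{1+|z|^2}{2}}\,\|f\|_1 .$$
   Context: For $\alpha\in\mathbb{R}\setminus\pi\mathbb{Z}$ put $a=\frac{\cot\alpha}{2}$ and $c(\alpha)=\sqrt{1-i\cot\alpha}$ (principal square root). For $z=\rho i$, $\rho\in\mathbb{R}\setminus\{0\}$, and $f\in L^1(\mathbb{R})$ (complex-valued), define $$\mathcal{O}_\alpha[f](s)=\frac{c(\alpha)}{\sqrt{2\pi}}\,e^{ias^2}\int_{\mathbb{R}}\frac{e^{-ist\csc\alpha}+z\,e^{ist\csc\alpha}}{2}\,e^{iat^2}f(t)\,dt,\qquad s\in\mathbb{R}.$$ $C_0(\mathbb{R})$ is the Banach space of continuous functions $\mathbb{R}\to\mathbb{C}$ vanishing at infinity, with the supremum norm $\|\cdot\|_\infty$; $\|f\|_1=\int_{\mathbb{R}}|f(t)|\,dt$. *)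

(* Defs.v *)
From HB Require Import structures.
From mathcomp Require Export all_boot all_order all_algebra.
From mathcomp Require Export all_classical all_reals all_analysis.
From mathcomp Require Export complex.

Set Implicit Arguments.
Unset Strict Implicit.
Unset Printing Implicit Defensive.

Import Order.TTheory GRing.Theory Num.Theory.
Import numFieldNormedType.Exports.

Local Open Scope classical_set_scope.
Local Open Scope ring_scope.
Local Open Scope complex_scope.

Local Notation Re := complex.Re.
Local Notation Im := complex.Im.

(* The modulus with values in R; the norm `|_| of R[i] has values in R[i]. *)
Notation normc := ComplexField.Normc.normc.

Definition cot (R : realType) (x : R) : R := cos x / sin x.

Definition csc (R : realType) (x : R) : R := (sin x)^-1.

Definition cexp (R : realType) (w : R[i]) : R[i] :=
  (expR (Re w))%:C * (cos (Im w) +i* sin (Im w)).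

Definition cintegral (R : realType) (g : R -> R[i]) : R[i] :=
  (\int[lebesgue_measure]_(t in [set: R]) Re (g t))
  +i* (\int[lebesgue_measure]_(t in [set: R]) Im (g t)).

Definition norm1 (R : realType) (f : R -> R[i]) : \bar R :=
  (\int[lebesgue_measure]_(t in [set: R]) (normc (f t))%:E)%E.

(* Representatives of the classes in L^1(R).  The library has no sigma-algebra
   on R[i]; Borel measurability is that of the real and imaginary parts. *)
Definition L1 (R : realType) : set (R -> R[i]) := [set f |
  [/\ measurable_fun [set: R] (fun t => Re (f t)),
      measurable_fun [set: R] (fun t => Im (f t)) &
      (norm1 f < +oo)%E]].

(* A supremum over all of R, not an essential supremum. *)
Definition norm_infty (R : realType) (F : R -> R[i]) : \bar R :=
  ereal_sup [set (normc (F s))%:E | s in [set: R]].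

(* R[i]^o carries the topology of the modulus. *)
Definition C0 (R : realType) : set (R -> R[i]) := [set F |
  [/\ continuous (F : R -> R[i]^o),
      (F : R -> R[i]^o) @ +oo --> (0 : R[i]^o) &
      (F : R -> R[i]^o) @ -oo --> (0 : R[i]^o)]].

(* T acts on representatives; the second clause makes it act on the classes
   modulo equality almost everywhere that form L^1(R). *)
Definition bounded_linear_L1_C0 (R : realType)
    (T : (R -> R[i]) -> (R -> R[i])) : Prop :=
  [/\ forall f, L1 f -> C0 (T f),
      forall f g, L1 f -> L1 g ->
        f = g %[ae lebesgue_measure] -> T f = T g,
      forall (k : R[i]) f g, L1 f -> L1 g ->
        T (fun t => k * f t + g t) = (fun s => k * T f s + T g s) &
      exists M : R, forall f, L1 f ->
        (norm_infty (T f) <= M%:E * norm1 f)%E].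

(* The principal square root is sqrtc; sqrtC from the algebraic hierarchy
   chooses the root with nonnegative imaginary part instead. *)
Definition ccoef (R : realType) (alpha : R) : R[i] :=
  sqrtc (1 - 'i%C * (cot alpha)%:C).

Definition Otransform (R : realType) (alpha : R) (z : R[i])
    (f : R -> R[i]) (s : R) : R[i] :=
  let a := cot alpha / 2 in
  ccoef alpha / (Num.sqrt (2 * pi))%:C * cexp ('i%C * (a * s ^+ 2)%:C) *
  cintegral (fun t =>
    (cexp (- 'i%C * (s * t * csc alpha)%:C)
     + z * cexp ('i%C * (s * t * csc alpha)%:C)) / 2
    * cexp ('i%C * (a * t ^+ 2)%:C) * f t).

(* Main.v *)
Require Import Defs.
From mathcomp Require Import ring lra.
From mathcomp Require Import measurable_realfun lebesgue_integral_under.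
Import Order.TTheory GRing.Theory Num.Theory.
Import numFieldNormedType.Exports.
Import HBSimple HBNNSimple.
Local Open Scope classical_set_scope.
Local Open Scope ring_scope.
Local Open Scope complex_scope.

(** With the chirp [exp(i a t^2)] absorbed into [f], the kernel is
    [wave rho x = (e^{-ix} + i rho e^{ix}) / 2] at [x = s t csc alpha].  The real
    and imaginary parts of the integral are then combinations of real integrals
    [int h(t) cos(c s t + phi) dt] with [h] integrable, a sine being a cosine with
    phase [-pi/2].  These are continuous in [s] by domination and vanish at
    infinity by the Riemann-Lebesgue lemma, which is obtained by a monotone class
    argument: it holds for indicators of intervals by explicit integration, and it
    is stable under linear combinations and dominated pointwise limits.

    For the bound, [4 |wave rho x|^2 = 1 + rho^2 - 4 rho sin x cos x] is at most
    [2 (1 + rho^2)], and [|c(alpha)|^2 = |1 - i cot alpha| = |csc alpha|], so that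
    [|c(alpha)| <= |csc alpha|] because [|csc alpha| >= 1]. *)

(** * Induction principle for integrable real functions *)

(** The class grows in four stages: indicators of measurable sets cut down to a bounded interval, by
    Dynkin's pi-lambda theorem; simple functions cut down likewise, by linearity; nonnegative
    integrable functions, as dominated limits of these; and finally differences of positive and
    negative parts. *)
Lemma integrable_ind (R : realType) (V : set (R -> R)) :
  (forall a b, V \1_(`]a, b]%classic)) ->
  (forall (k : R) f g, V f -> V g -> V (fun t => k * f t + g t)) ->
  (forall (F : (R -> R)^nat) f G, (forall n, V (F n)) ->
     (@lebesgue_measure R).-integrable setT (EFin \o f) ->
     (@lebesgue_measure R).-integrable setT (EFin \o G) ->
     (forall n t, `|F n t| <= G t) ->
     (forall t, F n t @[n --> \oo] --> f t) -> V f) ->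
  forall f, (@lebesgue_measure R).-integrable setT (EFin \o f) -> V f.
Proof.
move=> Vitv Vlin Vlim.
(* A measurable set may have infinite measure. Cutting it with [E n] makes its indicator integrable
   and supplies [\1_(E n)] as a dominating function. *)
pose E (n : nat) : set R := `]- n%:R, n%:R]%classic.
have mE n : measurable (E n : set (measurableTypeR R)) by exact: measurable_itv.
have V0 : V (fun=> 0).
  by have := Vitv 0 0; rewrite set_itvoc0 indic0.
have VD f g : V f -> V g -> V (fun t => f t + g t).
  move=> Vf Vg; have := Vlin 1 f g Vf Vg.
  by under eq_fun do rewrite mul1r.
have int_E n : (@lebesgue_measure R).-integrable setT (EFin \o \1_(E n)).
  exact: integrable_indic_itv.
have int_AE n A : measurable (A : set (measurableTypeR R)) ->
    (@lebesgue_measure R).-integrable setT (EFin \o \1_(A `&` E n)).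
  move=> mA; apply: le_integrable (int_E n) => //.
    by apply/measurable_EFinP/measurable_indic; exact: measurableI.
  move=> t _ /=; rewrite lee_fin !ger0_norm ?indicE ?ler0n// ler_nat.
  by rewrite in_setI; case: (t \in A).
have VAE A : measurable (A : set (measurableTypeR R)) ->
    forall n, V \1_(A `&` E n).
  apply: (@dynkin_induction _ (measurableTypeR R) (@ocitv R)
    (fun A => forall n, V \1_(A `&` E n))) => //.
  - exact: ocitvI.
  - by move=> n; rewrite setTI; exact: Vitv.
  - move=> B oB n.
    have : ocitv (B `&` E n) by apply: ocitvI => //; exact: is_ocitv.
    by rewrite ocitvP => -[->|[x _ ->]]; [rewrite indic0|exact: Vitv].
  - move=> B mB VB n.
    (* The complement is taken inside [E n], where it becomes a difference of two functions already
       in the class. *)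
    rewrite (_ : \1_(~` B `&` E n) =
      (fun t => -1 * \1_(B `&` E n) t + \1_(E n) t)).
      exact: (Vlin _ _ _ (VB n) (Vitv _ _)).
    apply/funext => t; rewrite !indicE !in_setI in_setC.
    by case: (t \in B); case: (t \in E n); rewrite /= ?mulr0 ?mulN1r ?addNr ?oppr0 ?add0r ?addr0.
  - move=> B mB tB VB n.
    (* The indicator of the countable union is the limit of those of the finite unions; disjointness
       makes the latter sums of indicators. *)
    apply: (Vlim (fun N => \1_((\big[setU/set0]_(i < N) B i) `&` E n)) _
      (\1_(E n))) => //.
    + elim=> [|N IH]; first by rewrite big_ord0 set0I indic0.
      rewrite (_ : \1__ = (fun t =>
        \1_((\big[setU/set0]_(i < N) B i) `&` E n) t + \1_(B N `&` E n) t)).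
        exact: VD.
      apply/funext => t; rewrite !indicE big_ord_recr/= !in_setI in_setU.
      have [tN|] := boolP (t \in B N); last by rewrite orbF addr0.
      have [tU|] := boolP (t \in \big[setU/set0]_(i < N) B i); last first.
        by rewrite orFb add0r.
      exfalso; move: tN tU; rewrite !inE -bigcup_mkord => tN [i /= iN ti].
      have /trivIsetP/(_ i N I I) := tB.
      rewrite neq_ltn iN => /(_ isT) => BiN.
      by have : (B i `&` B N) t by []; rewrite BiN.
    + exact: int_AE (bigcup_measurable _).
    + move=> N t; rewrite ger0_norm !indicE ?ler0n// ler_nat in_setI.
      by case: (t \in \big[_/_]_(_ < _) _).
    + move=> t; rewrite indicE; apply: (@cvg_near_cst _ R^o).
      have [/set_mem [[i _ Bit] Et]|nt] := boolP (t \in (\bigcup_k B k `&` E n)).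
        (* The [N]-th union runs over indices below [N], so it contains [B i] from [N = i.+1] on. *)
        exists i.+1 => // N /= iN; rewrite indicE mem_set//; split => //.
        by rewrite -bigcup_mkord; exists i.
      near=> N; rewrite indicE memNset//.
      apply: contraNnot nt; rewrite -bigcup_mkord => -[[i iN Bit] Et].
      by apply/mem_set; split => //; exists i.
have Vnn f : (forall t, 0 <= f t) ->
    (@lebesgue_measure R).-integrable setT (EFin \o f) -> V f.
  move=> f0 intf; have mf := measurable_int _ intf.
  pose g := nnsfun_approx measurableT mf.
  have g_le n t : g n t <= f t.
    by rewrite -lee_fin nnsfun_approxE; apply: le_approx => // x _; rewrite lee_fin.
  (* The truncated simple functions still converge to [f], since each [t] lies in [E n] once [n]
     exceeds its absolute value, and [f] itself dominates them. *)
  apply: (Vlim (fun n t => g n t * \1_(E n) t) _ f) => //.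
  - move=> n.
    (* A simple function is the sum of its values times the indicators of its level sets; the factor
       [\1_(E n)] is absorbed into those sets. *)
    rewrite (_ : (fun _ => _) = (fun t =>
        \sum_(y <- finmap.enum_fset (fset_set (range (g n)))) y * \1_(g n @^-1` [set y] `&` E n) t)).
      elim: (finmap.enum_fset _) => [|y s IH].
        by under eq_fun do rewrite big_nil.
      under eq_fun do rewrite big_cons.
      by apply: Vlin => //; exact: VAE.
    apply/funext => t; rewrite fimfunE fsbig_finite//= mulr_suml.
    by apply: eq_bigr => y _; rewrite -mulrA indicI.
  - move=> n t; rewrite ger0_norm ?mulr_ge0//.
    by rewrite (le_trans _ (g_le n t))// ler_piMr// indicE lern1 leq_b1.
  - move=> t.
    have gf : g n t @[n --> \oo] --> f t.
      apply: (fine_cvg (f := fun n => (g n t)%:E)).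
      by apply: cvg_nnsfun_approx => // x _; rewrite lee_fin.
    apply: cvg_trans gf; apply: near_eq_cvg.
    near=> n; rewrite indicE mem_set ?mulr1//= /E/= in_itv/=.
    have : `|t| < n%:R by near: n; exact: nbhs_infty_gtr.
    by rewrite ltr_norml => /andP[-> /ltW].
move=> f intf.
rewrite (_ : f = (fun t => -1 * (f^\- t) + f^\+ t)); last first.
  apply/funext => t; by rewrite -[in LHS](funrposBneg f) mulN1r addrC.
apply: Vlin; apply: Vnn => //.
- exact: integrable_funrneg.
- exact: integrable_funrpos.
Unshelve. all: by end_near. Qed.

(** * Oscillatory integrals and the Riemann-Lebesgue lemma *)

Section oscillatory_integrals.
Context {R : realType}.
Notation mu := (@lebesgue_measure R).
Implicit Types (h : R -> R) (c phi : R).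

Let measurable_cos_affine c phi : measurable_fun [set: measurableTypeR R]
  (fun t => cos (c * t + phi)).
Proof.
apply: continuous_measurable_fun => t.
apply: continuous_comp; last exact: continuous_cos.
by apply: cvgD; [apply: cvgMr; exact: cvg_id|exact: cvg_cst].
Qed.

Lemma integrableM_cos h c phi : mu.-integrable setT (EFin \o h) ->
  mu.-integrable setT (EFin \o (fun t => h t * cos (c * t + phi))).
Proof.
move=> ih; apply: (le_integrable measurableT _ _ ih) => //.
  apply/measurable_EFinP/measurable_funM; last exact: measurable_cos_affine.
  by have /measurable_EFinP := measurable_int _ ih.
by move=> t _ /=; rewrite lee_fin normrM ler_piMr// cos_max.
Qed.

Lemma continuous_Rintegral_cos h c phi : mu.-integrable setT (EFin \o h) ->
  continuous (fun s => \int[mu]_(t in setT) (h t * cos (c * s * t + phi))).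
Proof.
move=> ih s.
apply: (@continuity_under_integral R _ _ mu
  (fun s t => h t * cos (c * s * t + phi)) setT _ (s - 1) (s + 1) _ _
  (fun t => `|h t|)) => //.
- by move=> r _; exact: integrableM_cos.
- apply: aeW => t _ r _; apply: cvgMr.
  apply: continuous_comp; last exact: continuous_cos.
  by apply: cvgD; [apply: cvgMl; apply: cvgMr; exact: cvg_id|exact: cvg_cst].
- exact: integrable_norm.
- by move=> r _; apply: aeW => t _; rewrite normrM ler_piMr// cos_max.
- by rewrite inE/= in_itv/=; apply/andP; split; lra.
Qed.

Lemma Rintegral_cos_itv a b c phi : a < b -> c != 0 ->
  \int[mu]_(t in `]a, b]) cos (c * t + phi) =
  (sin (c * b + phi) - sin (c * a + phi)) / c.
Proof.
move=> ab c0.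
have ccos : continuous (fun t => cos (c * t + phi)).
  move=> t; apply: continuous_comp; last exact: continuous_cos.
  by apply: cvgD; [apply: cvgMr; exact: cvg_id|exact: cvg_cst].
pose F t := sin (c * t + phi) / c.
have dF (t : R) : is_derive t 1 (F : R -> R^o) (cos (c * t + phi)).
  by rewrite /F; apply: is_derive_eq; rewrite /GRing.scale/=; field.
have cF : continuous (F : R -> R^o).
  move=> t; apply: differentiable_continuous; apply/derivable1_diffP.
  by case: (dF t).
(* Adding the endpoint [a], a null set, gives the closed interval on which the fundamental theorem
   of calculus is applied with primitive [F]. *)
rewrite /Rintegral integral_itv_obnd_cbnd; last first.
  by apply/measurable_EFinP; apply: measurable_funTS; exact: measurable_cos_affine.
rewrite (@continuous_FTC2 _ _ F)//=.
- by rewrite /F; field.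
- by apply: continuous_subspaceT.
- split.
  + by move=> t _; case: (dF t).
  + by apply: cvg_at_right_filter; exact: cF.
  + by apply: cvg_at_left_filter; exact: cF.
- by move=> t _; rewrite derive1E; case: (dF t).
Qed.

Lemma riemann_lebesgue h c phi : c != 0 -> mu.-integrable setT (EFin \o h) ->
  \int[mu]_(t in setT) (h t * cos (c * s * t + phi)) @[s --> +oo] --> 0.
Proof.
move=> c0 ih; apply/cvg_pinftyP => u uy.
pose I h n := \int[mu]_(t in setT) (h t * cos (c * u n * t + phi)).
(* Integrability is made part of the induction property, so that the integral may be split in the
   linear and limit steps. *)
suff [] : mu.-integrable setT (EFin \o h) /\ I h n @[n --> \oo] --> 0 by [].
move: h ih; apply: integrable_ind.
- move=> a b; split; first exact: integrable_indic_itv.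
  have [ba|ab] := leP b a.
    rewrite set_itv_ge ?bnd_simp -?leNgt// indic0 /I.
    under eq_fun do under eq_Rintegral do rewrite mul0r.
    by rewrite Rintegral_cst// mul0r; exact: cvg_cst.
  apply/cvgr0Pnorm_lt => e e0; near=> n.
  (* The explicit integral is a difference of two sines over [c * u n], hence at most
     [2 / (|c| u n)]; this threshold makes it smaller than [e]. *)
  have un : 2 / (e * `|c|) < u n.
    by near: n; move/cvgryPgt : uy; exact.
  have un0 : 0 < u n.
    by rewrite (le_lt_trans _ un)// divr_ge0// mulr_ge0// ltW.
  have cun : c * u n != 0 by rewrite mulf_neq0// gt_eqF.
  rewrite /I (_ : Rintegral _ _ _ =
      \int[mu]_(t in `]a, b]) cos (c * u n * t + phi)); last first.
    rewrite [RHS]Rintegral_mkcond; apply: eq_Rintegral => t _.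
    rewrite patchE indicE; case: (_ \in _); by rewrite ?mul1r ?mul0r.
  rewrite Rintegral_cos_itv// normrM normfV normrM (gtr0_norm un0).
  rewrite ltr_pdivrMr ?mulr_gt0 ?normr_gt0//.
  rewrite (@le_lt_trans _ _ 2)//.
    by rewrite (le_trans (ler_normB _ _))// -[2]/(1 + 1)%R lerD// sin_max.
  by move: un; rewrite ltr_pdivrMr ?mulr_gt0 ?normr_gt0// mulrCA [u n * _]mulrC.
- move=> k f g [If lf] [Ig lg]; split.
    exact: (integrableD measurableT (integrableZl measurableT k If) Ig).
  rewrite (_ : I _ = (fun n => k * I f n + I g n)).
    rewrite -[0]addr0 -{1}(mulr0 k).
    by apply: cvgD => //; exact: cvgMr.
  apply/funext => n; rewrite /I -RintegralZl//; last exact: integrableM_cos.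
  rewrite -RintegralD//; last exact: integrableM_cos.
    by apply: eq_Rintegral => t _; ring.
  exact: (integrableZl measurableT k (integrableM_cos _ (c * u n) phi If)).
- move=> F f G VF If IG FG Ff; split=> //.
  have mf : measurable_fun setT (EFin \o f) := measurable_int _ If.
  have [] // := @dominated_convergence _ _ _ mu _ measurableT
    (fun n => EFin \o F n) (EFin \o f) (EFin \o G).
  - by move=> n; exact: measurable_int (VF n).1.
  - by apply: aeW => t _; apply: cvg_EFin; [exact: nearW|exact: Ff].
  - by apply: aeW => t n _ /=; rewrite lee_fin.
  move=> _ /= lim0 _.
  apply/cvgr0Pnorm_lt => e e0.
  have e20 : 0 < e / 2 by rewrite divr_gt0.
  have lim0' : \int[mu]_(t in setT) `|F n t - f t| @[n --> \oo] --> 0.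
    exact: (fine_cvg lim0).
  (* One [N] is fixed by convergence in mean. Since the cosine is bounded by 1, replacing [f] by
     [F N] costs less than [e / 2] for every frequency at once, and the other half comes from the
     decay for [F N]. *)
  have [N HN] : exists N, \int[mu]_(t in setT) `|F N t - f t| < e / 2.
    move/cvgr0Pnorm_lt : lim0' => /(_ _ e20)[N _ /(_ N (leqnn N))] HN.
    by exists N; rewrite (le_lt_trans (ler_norm _)).
  move/cvgr0Pnorm_lt : (VF N).2 => /(_ _ e20); apply: filterS => n Fn.
  have IfF : mu.-integrable setT (EFin \o (fun t => f t - F N t)).
    exact: (integrableB measurableT If (VF N).1).
  rewrite (_ : I f n = I (F N) n + I (fun t => f t - F N t) n); last first.
    rewrite /I -RintegralD//; [|exact: (integrableM_cos _ _ _ (VF N).1)|exact: integrableM_cos].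
    by apply: eq_Rintegral => t _; ring.
  rewrite (le_lt_trans (ler_normD _ _))// [ltRHS]splitr ltrD//.
  apply: le_lt_trans HN; apply: le_trans (le_normr_Rintegral _ _) _ => //.
    exact: integrableM_cos.
  apply: le_Rintegral => //.
  + by apply: integrable_norm; exact: integrableM_cos.
  + apply: integrable_norm; exact: (integrableB measurableT (VF N).1 If).
  + by move=> t _; rewrite normrM distrC ler_piMr// cos_max.
Unshelve. all: by end_near. Qed.

End oscillatory_integrals.

Local Notation Re := complex.Re.
Local Notation Im := complex.Im.

(** * Real part, imaginary part and modulus *)

Section complex_modulus.
Context {R : realType}.
Implicit Types x y : R[i].

Lemma complex_ext x y : Re x = Re y -> Im x = Im y -> x = y.
Proof. by case: x => a b; case: y => c d /= -> ->. Qed.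

Lemma ReD x y : Re (x + y) = Re x + Re y.
Proof. by case: x; case: y. Qed.

Lemma ImD x y : Im (x + y) = Im x + Im y.
Proof. by case: x; case: y. Qed.

Lemma ReM x y : Re (x * y) = Re x * Re y - Im x * Im y.
Proof. by case: x => a b; case: y. Qed.

Lemma ImM x y : Im (x * y) = Re x * Im y + Im x * Re y.
Proof. by case: x => a b; case: y. Qed.

Lemma normc_ge0 x : 0 <= normc x.
Proof. by case: x => a b; exact: sqrtr_ge0. Qed.

Lemma sqr_normcE x : normc x ^+ 2 = Re x ^+ 2 + Im x ^+ 2.
Proof. by case: x => a b; rewrite /= sqr_sqrtr// addr_ge0// sqr_ge0. Qed.

Lemma normc_real (a : R) : normc a%:C = `|a|.
Proof. by rewrite /= expr0n/= addr0 sqrtr_sqr. Qed.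

Lemma normc_leReIm x : normc x <= `|Re x| + `|Im x|.
Proof.
rewrite -(@ler_pXn2r _ 2)// ?nnegrE ?normc_ge0 ?addr_ge0//.
rewrite sqr_normcE sqrrD !real_normK ?num_real// lerD2r lerDl.
by rewrite mulrn_wge0// mulr_ge0.
Qed.

Lemma normRe_le x : `|Re x| <= normc x.
Proof.
rewrite -(@ler_pXn2r _ 2)// ?nnegrE ?normc_ge0//.
by rewrite sqr_normcE real_normK ?num_real// lerDl sqr_ge0.
Qed.

Lemma normIm_le x : `|Im x| <= normc x.
Proof.
rewrite -(@ler_pXn2r _ 2)// ?nnegrE ?normc_ge0//.
by rewrite sqr_normcE real_normK ?num_real// lerDr sqr_ge0.
Qed.

Lemma cexp_iE (a : R) : cexp ('i%C * a%:C) = cos a +i* sin a.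
Proof.
by apply: complex_ext; rewrite /cexp /= !(mul0r, mul1r, mulr0, oppr0, add0r, addr0, expR0).
Qed.

Lemma cexpN_iE (a : R) : cexp (- 'i%C * a%:C) = cos a -i* sin a.
Proof.
have -> : - 'i%C * a%:C = 'i%C * (- a)%:C :> R[i].
  by apply: complex_ext; rewrite /=; ring.
by rewrite cexp_iE cosN sinN.
Qed.

Lemma normc_cexp_i (a : R) : normc (cexp ('i%C * a%:C)) = 1.
Proof. by rewrite cexp_iE /= cos2Dsin2 sqrtr1. Qed.

Lemma cvg_ReIm (T : Type) (F : set_system T) (FF : Filter F) (f : T -> R[i])
    (l : R[i]) :
  Re (f t) @[t --> F] --> Re l -> Im (f t) @[t --> F] --> Im l ->
  (f : T -> R[i]^o) @ F --> (l : R[i]^o).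
Proof.
(* In the order of [R[i]], positivity of [e +i* e'] forces [e' = 0], so the tolerance is a positive
   real. *)
move=> cRe cIm; apply/cvgrPdist_lt => -[e e'] /[!ltcE]/= /andP[/eqP e'0 e0].
have e20 : 0 < e / 2 by rewrite divr_gt0.
move/cvgrPdist_lt : cRe => /(_ _ e20); move/cvgrPdist_lt : cIm => /(_ _ e20).
apply: filterS2 => t Imt Ret.
rewrite e'0 complexr0 [ltLHS](_ : _ = (normc (l - f t))%:C)// ltcR.
rewrite (le_lt_trans (normc_leReIm _))// [ltRHS]splitr.
by case: l (f t) Ret Imt => [a b] [c d] /= Ret Imt; rewrite ltrD.
Qed.

End complex_modulus.

(** * Continuous functions vanishing at infinity *)

Section C0_functions.
Context {R : realType}.

Definition C0r : set (R -> R) := [set h |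
  [/\ continuous h, h @ +oo --> 0 & h @ -oo --> 0]].

Lemma C0rD (h k : R -> R) : C0r h -> C0r k -> C0r (fun s => h s + k s).
Proof.
move=> [ch hy hNy] [ck ky kNy]; split.
- by move=> s; apply: cvgD; [exact: ch|exact: ck].
- by rewrite -[0]addr0; exact: cvgD.
- by rewrite -[0]addr0; exact: cvgD.
Qed.

Lemma C0r_Rintegral_cos (h : R -> R) c phi : c != 0 ->
  (@lebesgue_measure R).-integrable setT (EFin \o h) ->
  C0r (fun s =>
    \int[lebesgue_measure]_(t in [set: R]) (h t * cos (c * s * t + phi))).
Proof.
move=> c0 ih; split.
- exact: continuous_Rintegral_cos.
- exact: riemann_lebesgue.
(* The substitution of [- s] for [s] moves the sign onto [c], so this is the limit at [+oo] for the
   frequency factor [- c]. *)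
- apply/cvgNy_compNP.
  have /(riemann_lebesgue h _ phi)/(_ ih) : - c != 0 by rewrite oppr_eq0.
  by under eq_fun do under eq_Rintegral do rewrite mulNr -mulrN.
Qed.

Lemma C0_ReIm (F : R -> R[i]) :
  C0r (fun s => Re (F s)) -> C0r (fun s => Im (F s)) -> C0 F.
Proof.
move=> [cR Ry RNy] [cI Iy INy]; split.
- by move=> s; apply: cvg_ReIm; [exact: cR|exact: cI].
- exact: cvg_ReIm.
- exact: cvg_ReIm.
Qed.

Lemma C0M (e F : R -> R[i]) (M : R) : continuous (e : R -> R[i]^o) ->
  (forall s, normc (e s) <= M) -> C0 F -> C0 (fun s => e s * F s).
Proof.
move=> ce eM [cF Fy FNy].
(* The bound [M] may be 0; [M + 1] is positive and can be divided by. *)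
have M0 : 0 < M + 1 by rewrite ltr_wpDl// (le_trans (normc_ge0 (e 0))).
have lim0 (G : set_system R) : Filter G ->
    (F : R -> R[i]^o) @ G --> (0 : R[i]^o) ->
    ((fun s => e s * F s) : R -> R[i]^o) @ G --> (0 : R[i]^o).
  move=> FG /cvgr0Pnorm_lt F0; apply/cvgr0Pnorm_lt => -[d d'].
  rewrite ltcE/= => /andP[/eqP d'0 d0].
  have : 0 < (d / (M + 1))%:C by rewrite ltcR divr_gt0.
  move=> /F0; apply: filterS => s.
  rewrite [ltLHS](_ : _ = (normc (F s))%:C)// ltcR => Fs.
  rewrite d'0 complexr0 [ltLHS](_ : _ = (normc (e s * F s))%:C)// ltcR.
  rewrite ComplexField.Normc.normcM; apply: (@le_lt_trans _ _ ((M + 1) * normc (F s))).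
    by rewrite ler_wpM2r ?normc_ge0// (le_trans (eM s))// lerDl.
  by rewrite mulrC -ltr_pdivlMr.
split; [|exact: lim0|exact: lim0].
by move=> s; apply: cvgM; [exact: ce|exact: cF].
Qed.

End C0_functions.

(** * Complex-valued integrable functions and their integrals *)

Section L1_functions.
Context {R : realType}.
Notation mu := (@lebesgue_measure R).
Implicit Types f g m : R -> R[i].

Lemma integrable_lincomb (k l : R) (h1 h2 : R -> R) :
  mu.-integrable setT (EFin \o h1) -> mu.-integrable setT (EFin \o h2) ->
  mu.-integrable setT (EFin \o (fun t => k * h1 t + l * h2 t)).
Proof.
move=> i1 i2; exact: (integrableD measurableT (integrableZl measurableT k i1)
  (integrableZl measurableT l i2)).
Qed.

Lemma Rintegral_lincomb (k l : R) (h1 h2 : R -> R) :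
  mu.-integrable setT (EFin \o h1) -> mu.-integrable setT (EFin \o h2) ->
  \int[mu]_(t in setT) (k * h1 t + l * h2 t) =
  k * \int[mu]_(t in setT) h1 t + l * \int[mu]_(t in setT) h2 t.
Proof.
move=> i1 i2; rewrite RintegralD ?RintegralZl//.
- exact: (integrableZl measurableT k i1).
- exact: (integrableZl measurableT l i2).
Qed.

Lemma measurable_normc f :
  measurable_fun [set: measurableTypeR R] (fun t => Re (f t)) ->
  measurable_fun [set: measurableTypeR R] (fun t => Im (f t)) ->
  measurable_fun [set: measurableTypeR R] (fun t => normc (f t)).
Proof.
move=> mR mI.
rewrite (_ : (fun t => _) = Num.sqrt \o (fun t => Re (f t) ^+ 2 + Im (f t) ^+ 2)).
  apply: measurableT_comp.
    by apply: continuous_measurable_fun; exact: sqrt_continuous.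
  by apply: measurable_funD; exact: measurable_funX.
by apply/funext => t /=; case: (f t).
Qed.

(** This follows from [|Re f|, |Im f| <= |f| <= |Re f| + |Im f|], and it reduces complex integrals
    to the theory of real ones. *)
Lemma L1P f : L1 f <->
  mu.-integrable setT (EFin \o (fun t => Re (f t))) /\
  mu.-integrable setT (EFin \o (fun t => Im (f t))).
Proof.
split=> [[mR mI foo]|[iR iI]].
  have int_le (h : R -> R) : measurable_fun [set: measurableTypeR R] h ->
      (forall t, `|h t| <= normc (f t)) -> mu.-integrable setT (EFin \o h).
    move=> mh hf; apply/integrableP; split; first exact/measurable_EFinP.
    apply: le_lt_trans foo; apply: ge0_le_integral => //.
    - by apply: measurableT_comp => //; exact/measurable_EFinP.
    - by apply/measurable_EFinP; exact: measurable_normc.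
    - by move=> t _; rewrite lee_fin hf.
  by split; apply: int_le => // t; [exact: normRe_le|exact: normIm_le].
have /measurable_EFinP mR := measurable_int _ iR.
have /measurable_EFinP mI := measurable_int _ iI.
split=> //.
have := integrableD measurableT (integrable_norm iR)
  (integrable_norm iI).
move=> /integrableP[mRI]; apply: le_lt_trans.
apply: ge0_le_integral => //.
- by move=> t _; rewrite lee_fin normc_ge0.
- by apply/measurable_EFinP; exact: measurable_normc.
- exact: measurableT_comp mRI.
- move=> t _ /=; rewrite lee_fin ger0_norm ?addr_ge0//.
  exact: normc_leReIm.
Qed.

Lemma cintegral_lincomb (k : R[i]) f g : L1 f -> L1 g ->
  cintegral (fun t => k * f t + g t) = k * cintegral f + cintegral g.
Proof.
move=> /L1P[fR fI] /L1P[gR gI]; apply: complex_ext.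
- rewrite ReD ReM /=.
  (* The factors 1 and the sign moved onto the coefficient give the integrand the shape required by
     [Rintegral_lincomb], at both levels. *)
  under eq_Rintegral do rewrite ReD ReM -[X in X + _]mul1r -[X in _ + X]mul1r -mulNr.
  rewrite !Rintegral_lincomb//; last exact: integrable_lincomb.
  by rewrite !mul1r mulNr.
- rewrite ImD ImM /=.
  under eq_Rintegral do rewrite ImD ImM -[X in X + _]mul1r -[X in _ + X]mul1r.
  rewrite !Rintegral_lincomb//; last exact: integrable_lincomb.
  by rewrite !mul1r.
Qed.

Lemma normc_cintegral_le f : L1 f -> ((normc (cintegral f))%:E <= norm1 f)%E.
Proof.
move=> L1f; have [fR fI] := (L1P f).1 L1f; have [mR mI foo] := L1f.
have mN : measurable_fun setT (EFin \o (fun t => normc (f t))).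
  by apply/measurable_EFinP; exact: measurable_normc.
have iN : mu.-integrable setT (EFin \o (fun t => normc (f t))).
  apply/integrableP; split => //; move: foo; congr (_ < _)%E.
  by apply: eq_integral => t _; rewrite /= ger0_norm ?normc_ge0.
have -> : norm1 f = (\int[mu]_(t in setT) normc (f t))%:E.
  rewrite fineK// ge0_fin_numE//.
  by apply: integral_ge0 => t _; rewrite lee_fin normc_ge0.
rewrite lee_fin; set I := cintegral f; set J := Rintegral _ _ _.
have [->|I0] := eqVneq (normc I) 0.
  by apply: Rintegral_ge0 => t _; exact: normc_ge0.
(* |I|^2 = Re I * (int Re f) + Im I * (int Im f), then Cauchy-Schwarz pointwise *)
have {}I0 : 0 < normc I by rewrite lt_neqAle eq_sym I0 normc_ge0.
rewrite -(ler_pM2l I0) -expr2 sqr_normcE -RintegralZl//.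
have -> : Re I ^+ 2 + Im I ^+ 2 =
    \int[mu]_(t in setT) (Re I * Re (f t) + Im I * Im (f t)).
  by rewrite Rintegral_lincomb// !expr2.
apply: le_Rintegral => //.
- exact: integrable_lincomb.
- exact: (integrableZl measurableT (normc I) iN).
- move=> t _; rewrite (le_trans (ler_norm _))// -(@ler_pXn2r _ 2)//.
    rewrite exprMn !sqr_normcE real_normK ?num_real//.
    rewrite -subr_ge0.
    (* Lagrange's identity: the defect in Cauchy-Schwarz is a square. *)
    rewrite [leRHS](_ : _ = (Re I * Im (f t) - Im I * Re (f t)) ^+ 2) ?sqr_ge0//.
    by ring.
  by rewrite nnegrE mulr_ge0// normc_ge0.
Qed.

(** The pointwise bound [|m f| <= M |f|] is integrated. It serves for the chirp, with [M = 1], and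
    for the kernel [wave]. *)
Lemma L1M m f (M : R) :
  measurable_fun [set: measurableTypeR R] (fun t => Re (m t)) ->
  measurable_fun [set: measurableTypeR R] (fun t => Im (m t)) ->
  (forall t, normc (m t) <= M) -> L1 f ->
  L1 (fun t => m t * f t) /\ (norm1 (fun t => m t * f t)%R <= M%:E * norm1 f)%E.
Proof.
move=> mmR mmI mM [mR mI foo].
have M0 : 0 <= M by exact: le_trans (normc_ge0 _) (mM 0).
have mmfR : measurable_fun [set: measurableTypeR R] (fun t => Re (m t * f t)).
  under eq_fun do rewrite ReM.
  by apply: measurable_funB; exact: measurable_funM.
have mmfI : measurable_fun [set: measurableTypeR R] (fun t => Im (m t * f t)).
  under eq_fun do rewrite ImM.
  by apply: measurable_funD; exact: measurable_funM.
have le1 : (norm1 (fun t => m t * f t)%R <= M%:E * norm1 f)%E.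
  rewrite /norm1 -ge0_integralZl_EFin//.
  - apply: ge0_le_integral => //.
    + by move=> t _; rewrite lee_fin normc_ge0.
    + by apply/measurable_EFinP; exact: measurable_normc.
    + apply/measurable_EFinP/measurable_funM => //; exact: measurable_normc.
    + move=> t _; rewrite -EFinM lee_fin ComplexField.Normc.normcM.
      by rewrite ler_wpM2r// normc_ge0.
  - by move=> t _; rewrite lee_fin normc_ge0.
  - by apply/measurable_EFinP; exact: measurable_normc.
split=> //; split=> //.
apply: le_lt_trans le1 _; rewrite lte_mul_pinfty// lee_fin//.
Qed.

End L1_functions.

(** * The normalizing constant and the kernel *)

Section kernel.
Context {R : realType}.
Notation mu := (@lebesgue_measure R).
Implicit Types (f g : R -> R[i]) (alpha rho c s t : R).

(** Subtracting [floor (x / pi)] times [pi] moves [x] into the open interval from 0 to [pi], where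
    the sine is positive, and changes the sine by at most a sign. *)
Lemma sin_neq0 (x : R) : (forall k : int, x != k%:~R * pi) -> sin x != 0.
Proof.
move=> xkpi; apply/eqP => sinx.
have pi0 := pi_gt0 R.
pose k := Num.floor (x / pi); pose y := x - k%:~R * pi.
have /andP[kx xk] : k%:~R <= x / pi < (k + 1)%:~R by exact: floor_itv.
have y0 : 0 < y.
  rewrite lt_neqAle subr_ge0 eq_sym subr_eq0 xkpi/=.
  by rewrite -ler_pdivlMr.
have ypi : y < pi.
  rewrite ltrBlDr -[X in _ < X + _]mul1r -mulrDl -ltr_pdivrMr//.
  by rewrite addrC; move: xk; rewrite intrD.
suff siny : sin y = 0.
  by have := sin_gt0_pi (introT andP (conj y0 ypi)); rewrite siny ltxx.
(* The antiperiodicity of the sine is iterated a natural number of times, so the sign of [k] is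
   split: for nonnegative [k] one goes from [y] up to [x], for negative [k] from [x] up to [y]. *)
rewrite /y; case: (k) => n.
  have := alternatingn (@sinDpi R) n (x - n%:R * pi).
  rewrite -[pi *+ n]mulr_natl subrK sinx => /esym/eqP.
  by rewrite mulf_eq0 signr_eq0/= => /eqP.
rewrite NegzE mulrNz mulNr opprK -[_%:~R]/(n.+1%:R) mulr_natl.
by rewrite (alternatingn (@sinDpi R)) sinx mulr0.
Qed.

Lemma normc_ccoef alpha : sin alpha != 0 ->
  normc (ccoef alpha) = Num.sqrt `|csc alpha|.
Proof.
move=> sa; set c := ccoef alpha.
have c2 : c ^+ 2 = 1 - 'i%C * (cot alpha)%:C by exact: sqr_sqrtc.
suff sqc : normc c ^+ 2 = `|csc alpha|.
  by rewrite -sqc sqrtr_sqr ger0_norm// normc_ge0.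
rewrite expr2 -ComplexField.Normc.normcM -expr2 c2 -[RHS]sqrtr_sqr.
rewrite /cot /csc /=; congr Num.sqrt.
have sE : (sin alpha)^-1 ^+ 2 =
    (cos alpha ^+ 2 + sin alpha ^+ 2) / sin alpha ^+ 2.
  by rewrite cos2Dsin2 mul1r exprVn.
by rewrite sE; field.
Qed.

(** The exact modulus is the square root of [|csc alpha|], and a number that is at least 1 dominates
    its square root. *)
Lemma normc_ccoef_le alpha : sin alpha != 0 ->
  normc (ccoef alpha) <= `|csc alpha|.
Proof.
move=> sa; rewrite normc_ccoef// -[leRHS]sqr_sqrtr// expr2 ler_peMl//.
rewrite -[leLHS]sqrtr1 ler_wsqrtr// normfV invf_ge1 ?normr_gt0//.
exact: sin_max.
Qed.

(** Spelling out both coordinates lets the products with [g] be expanded into real integrands. *)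
Definition wave rho x : R[i] :=
  ((cos x - rho * sin x) / 2) +i* ((rho * cos x - sin x) / 2).

Lemma waveE rho x :
  (cexp (- 'i%C * x%:C) + rho%:C * 'i%C * cexp ('i%C * x%:C)) / 2 = wave rho x.
Proof.
have two0 : (2 : R[i]) != 0 by rewrite pnatr_eq0.
apply: (mulIf two0); rewrite mulfVK// cexp_iE cexpN_iE.
rewrite [RHS](_ : _ = wave rho x + wave rho x); last by ring.
by apply: complex_ext; rewrite /wave /=; field.
Qed.

Lemma normc_wave_le rho x :
  normc (wave rho x) <= Num.sqrt ((1 + rho ^+ 2) / 2).
Proof.
rewrite ler_wsqrtr//.
pose N := cos x ^+ 2 + sin x ^+ 2.
have N1 : N = 1 by exact: cos2Dsin2.
have -> : ((cos x - rho * sin x) / 2) ^+ 2 + ((rho * cos x - sin x) / 2) ^+ 2 =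
    ((1 + rho ^+ 2) * N - 4 * rho * sin x * cos x) / 4.
  by rewrite /N; field.
(* This is the gap between [(1 + rho^2) / 2] and [|wave rho x|^2]: it equals [((rho + sin 2x)^2 +
   (cos 2x)^2) / 4 = (1 + rho^2 + 2 rho sin 2x) / 4]. *)
have : 0 <= ((rho + 2 * sin x * cos x) ^+ 2 + (cos x ^+ 2 - sin x ^+ 2) ^+ 2) / 4.
  by rewrite divr_ge0// addr_ge0// sqr_ge0.
rewrite (_ : _ / 4 = (rho ^+ 2 + 4 * rho * sin x * cos x + N ^+ 2) / 4).
  by rewrite N1; lra.
by rewrite /N; field.
Qed.

Lemma C0_cintegral_wave rho c g : c != 0 -> L1 g ->
  C0 (fun s => cintegral (fun t => wave rho (s * t * c) * g t)).
Proof.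
move=> c0 /L1P[gR gI].
(* Both coordinates of the integral have this form; the sine term is the cosine term with phase
   [- (pi / 2)]. *)
have main (k1 l1 k2 l2 : R) : C0r (fun s => \int[mu]_(t in setT)
   (cos (s * t * c) * (k1 * Re (g t) + l1 * Im (g t)) +
    sin (s * t * c) * (k2 * Re (g t) + l2 * Im (g t)))).
  have i1 := integrable_lincomb k1 l1 _ _ gR gI.
  have i2 := integrable_lincomb k2 l2 _ _ gR gI.
  have := C0rD _ _ (C0r_Rintegral_cos _ c 0 c0 i1)
    (C0r_Rintegral_cos _ c (- (pi / 2)) c0 i2).
  congr C0r; apply/funext => s; rewrite -RintegralD//; [|exact: integrableM_cos..].
  apply: eq_Rintegral => t _; rewrite cosBpihalf addr0.
  by rewrite (_ : c * s * t = s * t * c); [ring|ring].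
apply: C0_ReIm.
(* The four numbers are the coefficients of [cos Re g], [cos Im g], [sin Re g] and [sin Im g] in the
   real part of [wave * g]; the next case does the same for the imaginary part. *)
- have := main (1 / 2) (- rho / 2) (- rho / 2) (1 / 2).
  congr C0r; apply/funext => s; apply: eq_Rintegral => t _.
  by rewrite ReM /=; field.
- have := main (rho / 2) (1 / 2) (- 1 / 2) (- rho / 2).
  congr C0r; apply/funext => s; apply: eq_Rintegral => t _.
  by rewrite ImM /=; field.
Qed.

End kernel.

(** * Mapping properties and norm estimate of the transform *)

Section Otransform_estimates.
Context {R : realType}.
Notation mu := (@lebesgue_measure R).
Implicit Types (f : R -> R[i]) (alpha rho s t : R).

Definition chirp (a t : R) : R[i] := cexp ('i%C * (a * t ^+ 2)%:C).

Lemma normc_chirp a t : normc (chirp a t) = 1.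
Proof. exact: normc_cexp_i. Qed.

Lemma OtransformE alpha rho f s : let a := cot alpha / 2 in
  Otransform alpha (rho%:C * 'i%C) f s =
  ccoef alpha / (Num.sqrt (2 * pi))%:C * chirp a s *
  cintegral (fun t => wave rho (s * t * csc alpha) * (chirp a t * f t)).
Proof.
rewrite /Otransform /=; congr (_ * cintegral _).
by apply/funext => t; rewrite waveE -mulrA.
Qed.

Lemma L1_chirp (a : R) f : L1 f ->
  L1 (fun t => chirp a t * f t) /\
  (norm1 (fun t => chirp a t * f t)%R <= norm1 f)%E.
Proof.
have csq : continuous (fun t : R => a * t ^+ 2).
  by move=> t; apply: cvgMr; exact: exprn_continuous.
rewrite -[X in (_ <= X)%E]mul1e; apply: L1M => [||t].
- under eq_fun do rewrite /chirp cexp_iE.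
  apply: continuous_measurable_fun => t.
  by apply: continuous_comp; [exact: csq|exact: continuous_cos].
- under eq_fun do rewrite /chirp cexp_iE.
  apply: continuous_measurable_fun => t.
  by apply: continuous_comp; [exact: csq|exact: continuous_sin].
- by rewrite normc_chirp.
Qed.

Lemma L1_wave rho (c : R) f s : L1 f ->
  L1 (fun t => wave rho (s * t * c) * f t) /\
  (norm1 (fun t => wave rho (s * t * c) * f t)%R <=
   (Num.sqrt ((1 + rho ^+ 2) / 2))%:E * norm1 f)%E.
Proof.
have cst : continuous (fun t : R => s * t * c).
  by move=> t; apply: cvgMl; apply: cvgMr; exact: cvg_id.
have mcos : measurable_fun [set: measurableTypeR R] (fun t => cos (s * t * c)).
  apply: continuous_measurable_fun => t.
  by apply: continuous_comp; [exact: cst|exact: continuous_cos].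
have msin : measurable_fun [set: measurableTypeR R] (fun t => sin (s * t * c)).
  apply: continuous_measurable_fun => t.
  by apply: continuous_comp; [exact: cst|exact: continuous_sin].
apply: L1M => [||t]; last exact: normc_wave_le.
- by apply: measurable_funM => //; apply: measurable_funB => //;
    exact: measurable_funM.
- by apply: measurable_funM => //; apply: measurable_funB => //;
    exact: measurable_funM.
Qed.

Lemma eq_ae_cintegral f g : L1 f -> L1 g -> f = g %[ae mu] ->
  cintegral f = cintegral g.
Proof.
move=> /L1P[fR fI] /L1P[gR gI] fg; apply: complex_ext; congr fine.
- apply: ae_eq_integral => //; [exact: measurable_int fR|exact: measurable_int gR|].
  exact: (ae_eq_comp2 (fun _ x => (Re x)%:E) fg).
- apply: ae_eq_integral => //; [exact: measurable_int fI|exact: measurable_int gI|].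
  exact: (ae_eq_comp2 (fun _ x => (Im x)%:E) fg).
Qed.

(** The factor in front of the integral is continuous of constant modulus, so [C0M] applies; the
    integral is covered by [C0_cintegral_wave] because [csc alpha] is nonzero. *)
Lemma C0_Otransform alpha rho f : sin alpha != 0 -> L1 f ->
  C0 (Otransform alpha (rho%:C * 'i%C) f).
Proof.
move=> sa L1f; set C := ccoef alpha / (Num.sqrt (2 * pi))%:C.
pose a := cot alpha / 2.
rewrite (_ : Otransform _ _ _ = (fun s => C * chirp a s *
    cintegral (fun t => wave rho (s * t * csc alpha) * (chirp a t * f t)))).
  apply: (C0M _ _ (normc C)) => [s|s|].
  - apply: cvgMr; apply: cvg_ReIm.
      under eq_fun do rewrite /chirp cexp_iE; rewrite /chirp cexp_iE.
      apply: continuous_comp; last exact: continuous_cos.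
      by apply: cvgMr; exact: exprn_continuous.
    under eq_fun do rewrite /chirp cexp_iE; rewrite /chirp cexp_iE.
    apply: continuous_comp; last exact: continuous_sin.
    by apply: cvgMr; exact: exprn_continuous.
  - by rewrite ComplexField.Normc.normcM normc_chirp mulr1.
  - apply: C0_cintegral_wave; first by rewrite invr_eq0.
    exact: (L1_chirp a f L1f).1.
by apply/funext => s; rewrite OtransformE.
Qed.

Lemma norm_infty_Otransform_le alpha rho f : sin alpha != 0 -> L1 f ->
  (norm_infty (Otransform alpha (rho%:C * 'i%C)%R f) <=
   (`|csc alpha| / Num.sqrt (2 * pi) * Num.sqrt ((1 + rho ^+ 2) / 2))%:E
   * norm1 f)%E.
Proof.
move=> sa L1f; apply: ub_ereal_sup => _ [s _ <-].
have [L1c le_c] := L1_chirp (cot alpha / 2) f L1f.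
have [L1w le_w] := L1_wave rho (csc alpha) _ s L1c.
rewrite OtransformE 3!ComplexField.Normc.normcM normc_chirp mulr1.
rewrite ComplexField.Normc.normcV normc_real ger0_norm ?sqrtr_ge0//.
have f0 : (0 <= norm1 f)%E.
  by apply: integral_ge0 => t _; rewrite lee_fin normc_ge0.
(* Both sides are regrouped so that the outer constants are compared with each other, and the
   integral with the kernel bound times [norm1 f]. *)
rewrite [leLHS]EFinM [X in (_ <= X * _)%E]EFinM -muleA.
apply: lee_pmul; rewrite ?lee_fin ?normc_ge0 ?mulr_ge0 ?invr_ge0 ?sqrtr_ge0 ?normc_ge0//.
  by rewrite ler_wpM2r ?invr_ge0 ?sqrtr_ge0// normc_ccoef_le.
apply: le_trans (normc_cintegral_le _ L1w) _; apply: le_trans le_w _.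
by apply: lee_wpmul2l => //; rewrite lee_fin sqrtr_ge0.
Qed.

Lemma Otransform_ae alpha rho f g : L1 f -> L1 g -> f = g %[ae mu] ->
  Otransform alpha (rho%:C * 'i%C) f = Otransform alpha (rho%:C * 'i%C) g.
Proof.
move=> L1f L1g fg; apply/funext => s; rewrite !OtransformE; congr (_ * _).
have [L1fc _] := L1_chirp (cot alpha / 2) f L1f.
have [L1gc _] := L1_chirp (cot alpha / 2) g L1g.
apply: eq_ae_cintegral.
- exact: (L1_wave rho (csc alpha) _ s L1fc).1.
- exact: (L1_wave rho (csc alpha) _ s L1gc).1.
(* The integrand at [t] depends on the function only through its value there, so equality almost
   everywhere is inherited. *)
- pose j t (x : R[i]) : R[i] :=
    wave rho (s * t * csc alpha) * (chirp (cot alpha / 2) t * x).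
  exact: (ae_eq_comp2 (mu := mu) j fg).
Qed.

Lemma Otransform_lincomb alpha rho (k : R[i]) f g : L1 f -> L1 g ->
  Otransform alpha (rho%:C * 'i%C) (fun t => k * f t + g t) =
  (fun s => k * Otransform alpha (rho%:C * 'i%C) f s +
            Otransform alpha (rho%:C * 'i%C) g s).
Proof.
move=> L1f L1g; apply/funext => s; rewrite !OtransformE.
have [L1fc _] := L1_chirp (cot alpha / 2) f L1f.
have [L1gc _] := L1_chirp (cot alpha / 2) g L1g.
have [L1fw _] := L1_wave rho (csc alpha) _ s L1fc.
have [L1gw _] := L1_wave rho (csc alpha) _ s L1gc.
rewrite [k * _]mulrCA -mulrDr -cintegral_lincomb//; congr (_ * cintegral _).
by apply/funext => t; ring.
Qed.

End Otransform_estimates.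

Theorem mainTheorem1 (R : realType) (alpha rho : R) (z : R[i])
    (halpha : forall k : int, alpha != k%:~R * pi)
    (hrho : rho != 0) (hz : z = rho%:C * 'i%C) :
  [/\ bounded_linear_L1_C0 (Otransform alpha z),
      forall f : R -> R[i], L1 f -> C0 (Otransform alpha z f) &
      forall f : R -> R[i], L1 f ->
        (norm_infty (Otransform alpha z f)
         <= (`|csc alpha| / Num.sqrt (2 * pi)
             * Num.sqrt ((1 + normc z ^+ 2) / 2))%:E * norm1 f)%E].
Proof.
have sa := sin_neq0 _ halpha; rewrite {}hz.
have -> : normc (rho%:C * 'i%C) ^+ 2 = rho ^+ 2.
  by rewrite sqr_normcE ReM ImM /=; ring.
split; last by move=> f; exact: norm_infty_Otransform_le.
- split.
  + by move=> f; exact: C0_Otransform.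
  + by move=> f g; exact: Otransform_ae.
  + by move=> k f g; exact: Otransform_lincomb.
  (* The witness is read off from the norm estimate, whose constant is independent of [f]. *)
  + by eexists => f; exact: norm_infty_Otransform_le.
- by move=> f; exact: C0_Otransform.
Qed.
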